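(* For an integer $n>2$ let $F(n-1,n)$ be the group with generators $x_1,\dots,x_n$ and the $n$ relations $$x_1x_2\cdots x_{n-1}=x_n,\quad x_2x_3\cdots x_n=x_1,\quad \dots,\quad x_nx_1\cdots x_{n-2}=x_{n-1},$$ i.e. $x_ix_{i+1}\cdots x_{i+n-2}=x_{i+n-1}$ for $i=1,\dots,n$, with subscripts taken modulo $n$. Then $F(n-1,n)$ is not left-orderable.
   Context: A group $G$ is left-orderable if there is a strict total ordering $\prec$ of its elements which is left-invariant: $x\prec y$ iff $zx\prec zy$ for all $x,y,z\in G$. *)

(* Defs.v *)
From HB Require Import structures.
From mathcomp Require Import all_boot.
From mathcomp Require Import boolp.

Set Implicit Arguments.
Unset Strict Implicit.
Unset Printing Implicit Defensive.

Import Algebra.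

Local Open Scope group_scope.
Local Open Scope quotient_scope.

Record strict_total_order (T : Type) (lt : T -> T -> Prop) : Prop := {
  sto_irr : forall x, ~ lt x x;
  sto_trans : forall x y z, lt x y -> lt y z -> lt x z;
  sto_total : forall x y, x <> y -> lt x y \/ lt y x
}.

Definition left_invariant (G : groupType) (lt : G -> G -> Prop) : Prop :=
  forall x y z : G, lt x y <-> lt (z * x) (z * y).

Definition left_orderable (G : groupType) : Prop :=
  exists lt : G -> G -> Prop, strict_total_order lt /\ left_invariant lt.

(* A word over the alphabet X and its formal inverses: the letter (x, false)
   stands for the generator x and (x, true) for its inverse. *)
Definition word (X : choiceType) : Type := seq (X * bool).

Definition word_inv (X : choiceType) (w : word X) : word X :=
  rev [seq (a.1, ~~ a.2) | a <- w].

(* The congruence on words generated by free cancellation and by the relations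
   u = v for rels u v. *)
Inductive pres_eq (X : choiceType) (rels : word X -> word X -> Prop) :
    word X -> word X -> Prop :=
| pres_eq_refl u : pres_eq rels u u
| pres_eq_sym u v : pres_eq rels u v -> pres_eq rels v u
| pres_eq_trans u v w :
    pres_eq rels u v -> pres_eq rels v w -> pres_eq rels u w
| pres_eq_cat u u' v v' :
    pres_eq rels u u' -> pres_eq rels v v' -> pres_eq rels (u ++ v) (u' ++ v')
| pres_eq_cancel x b : pres_eq rels [:: (x, b); (x, ~~ b)] [::]
| pres_eq_rel u v : rels u v -> pres_eq rels u v.

Section Presentation.
Variables (X : choiceType) (rels : word X -> word X -> Prop).

Definition pres_eqb : rel (seq (X * bool)) := fun u v => `[< pres_eq rels u v >].

Lemma pres_eqb_refl : reflexive pres_eqb.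
Proof. by move=> u; apply/asboolP/pres_eq_refl. Qed.

Lemma pres_eqb_sym : symmetric pres_eqb.
Proof. by move=> u v; apply/asboolP/asboolP; apply: pres_eq_sym. Qed.

Lemma pres_eqb_trans : transitive pres_eqb.
Proof.
move=> v u w /asboolP uv /asboolP vw; apply/asboolP.
exact: pres_eq_trans uv vw.
Qed.

Canonical pres_equiv := EquivRel pres_eqb pres_eqb_refl pres_eqb_sym pres_eqb_trans.

(* The group < X | rels >, with carrier the quotient of words by pres_eq. *)
Definition presented_group : Type := {eq_quot pres_equiv}.

HB.instance Definition _ := Choice.on presented_group.
HB.instance Definition _ := EqQuotient.on presented_group.

Definition pres_class (w : word X) : presented_group := \pi_presented_group w.

Definition pres_mul (a b : presented_group) : presented_group :=
  pres_class (repr a ++ repr b).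

Definition pres_one : presented_group := pres_class [::].

Definition pres_inv (a : presented_group) : presented_group :=
  pres_class (word_inv (repr a)).

Lemma pres_classP u v : pres_class u = pres_class v <-> pres_eq rels u v.
Proof.
by split=> [/eqmodP/asboolP|uv] //; apply/eqmodP/asboolP.
Qed.

Lemma pres_class_repr a : pres_class (repr a) = a.
Proof. exact: reprK. Qed.

Lemma pres_repr_class u : pres_eq rels (repr (pres_class u)) u.
Proof. by apply/pres_classP; rewrite pres_class_repr. Qed.

Lemma pres_mul_class u v :
  pres_mul (pres_class u) (pres_class v) = pres_class (u ++ v).
Proof. by apply/pres_classP/pres_eq_cat; apply: pres_repr_class. Qed.

Lemma word_invK : involutive (@word_inv X).
Proof.
move=> w; rewrite /word_inv map_rev revK -map_comp map_id_in // => -[x b] _ /=.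
by rewrite negbK.
Qed.

Lemma word_mulV (w : word X) : pres_eq rels (w ++ word_inv w) [::].
Proof.
elim: w => [|[x b] w IH]; first exact: pres_eq_refl.
rewrite /word_inv /= rev_cons -cats1 catA.
apply: pres_eq_trans (pres_eq_cancel rels x b).
rewrite -[_ :: _ ++ _]/(([:: (x, b)] ++ (w ++ word_inv w)) ++ [:: (x, ~~ b)]).
rewrite -[[:: _; _]]/(([:: (x, b)] ++ [::]) ++ [:: (x, ~~ b)]).
by do 2![apply: pres_eq_cat; try exact: pres_eq_refl].
Qed.

Lemma pres_mulgV : right_inverse pres_one pres_inv pres_mul.
Proof.
move=> a; rewrite -{1}[a]pres_class_repr pres_mul_class.
by apply/pres_classP/word_mulV.
Qed.

Lemma pres_mulVg : left_inverse pres_one pres_inv pres_mul.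
Proof.
move=> a; rewrite -{2}[a]pres_class_repr pres_mul_class; apply/pres_classP.
by rewrite -{2}[repr a]word_invK; apply: word_mulV.
Qed.

Lemma pres_mulA : associative pres_mul.
Proof.
move=> a b c; rewrite -[a]pres_class_repr -[b]pres_class_repr.
by rewrite -[c]pres_class_repr !pres_mul_class catA.
Qed.

Lemma pres_mul1g : left_id pres_one pres_mul.
Proof. by move=> a; rewrite -[a]pres_class_repr pres_mul_class. Qed.

Lemma pres_mulg1 : right_id pres_one pres_mul.
Proof. by move=> a; rewrite -[a]pres_class_repr pres_mul_class cats0. Qed.

HB.instance Definition _ := isGroup.Build presented_group
  pres_mulA pres_mul1g pres_mulg1 pres_mulVg pres_mulgV.

Definition pres_gen (x : X) : presented_group := pres_class [:: (x, false)].

Definition word_eval (H : groupType) (f : X -> H) (w : word X) : H :=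
  \prod_(a <- w) (if a.2 then (f a.1)^-1 else f a.1).

Lemma pres_classE (w : word X) : pres_class w = word_eval pres_gen w.
Proof.
rewrite /word_eval; elim: w => [|[x b] w IH]; first by rewrite big_nil.
rewrite big_cons -IH -[_ :: w]cat1s -pres_mul_class; congr (_ * _).
case: b => //=; apply: (@mulgI _ (pres_gen x)); rewrite mulgV.
by rewrite [LHS]pres_mul_class; apply/pres_classP/pres_eq_cancel.
Qed.

Lemma pres_rel (u v : word X) :
  rels u v -> word_eval pres_gen u = word_eval pres_gen v.
Proof. by move=> uv; rewrite -!pres_classE; apply/pres_classP/pres_eq_rel. Qed.

Lemma pres_universal (H : groupType) (f : X -> H) :
  (forall u v, rels u v -> word_eval f u = word_eval f v) ->
  exists2 phi : presented_group -> H,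
    {morph phi : a b / a * b} & forall x, phi (pres_gen x) = f x.
Proof.
move=> frel.
have fcong u v : pres_eq rels u v -> word_eval f u = word_eval f v.
  elim=> {u v} [//|u v _ ->//|u v w _ -> _ ->//|u u' v v' _ e1 _ e2|x b|//].
    by rewrite /word_eval !big_cat /= -/(word_eval f _) e1 -/(word_eval f _) e2.
  by rewrite /word_eval !big_cons big_nil mulg1; case: b; rewrite /= ?mulVg ?mulgV.
exists (fun a => word_eval f (repr a)) => [a b|x].
  by rewrite (fcong _ _ (pres_repr_class _)) /word_eval big_cat.
by rewrite (fcong _ _ (pres_repr_class _)) /word_eval big_seq1.
Qed.

End Presentation.

(* The i-th relation x_i x_{i+1} ... x_{i+r-1} = x_{i+r}, for i in 'I_n (so the
   generators are numbered from 0); ordS is the cyclic successor on 'I_n, hence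
   iter k ordS i is the index i + k modulo n. *)
Definition fib_rels (r n : nat) (u v : word 'I_n) : Prop :=
  exists i : 'I_n,
    u = [seq (iter k (@ordS n) i, false) | k <- iota 0 r] /\
    v = [:: (iter r (@ordS n) i, false)].

Definition fibonacci_group (r n : nat) : groupType :=
  presented_group (@fib_rels r n).

(* Main.v *)
Require Import Defs.
From mathcomp Require Import all_boot.
From mathcomp Require Import perm.

Set Implicit Arguments.
Unset Strict Implicit.
Unset Printing Implicit Defensive.

Import Algebra.

Local Open Scope group_scope.

(** Write $r = n - 1 \ge 2$ and read the generators as a sequence
    $a_0, a_1, \dots$ of period $r + 1$. The product
    $a_i a_{i+1} \cdots a_{i+r}$ can be shortened by the defining relations in
    two ways: the first $r$ factors give $a_{i+r}$, and the last $r$ factors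
    give $a_{i+r+1} = a_i$. So $a_{i+r}^2 = a_i^2$, and by periodicity all the
    generators have the same square ([sqr_const]).

    In a left-ordered group an element and its square lie on the same side of
    the identity, so either every generator is $1$, or all are positive, or all
    are negative; reversing the order reduces the last case to the second.
    Positivity is absurd: the relation
    $a_i = a_{i+1} (a_{i+2} \cdots a_{i+r})$ has a nonempty positive second
    factor because $r \ge 2$, hence $a_{i+1} \prec a_i$ for every $i$,
    and the sequence would decrease strictly all the way around a cycle
    ([not_all_pos]).

    Thus all the generators are $1$. As the trivial group is left-orderable,
    it remains to see that the group is not trivial: in a group of order $2$
    the relations only ask that the product of all the generators be $1$, so
    two generators may be sent to the involution and the others to $1$
    ([fibonacci_gen_neq1]). *)

(** * Left-invariant orders *)

Section LeftOrder.
Variables (G : groupType) (lt : G -> G -> Prop).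
Hypotheses (lt_order : strict_total_order lt) (lt_inv : left_invariant lt).

Lemma pos_mul (x y : G) : lt 1 y -> lt x (x * y).
Proof. by move/(lt_inv _ _ x); rewrite mulg1. Qed.

Lemma pos_prod (m : nat) (a : nat -> G) :
  (forall i, lt 1 (a i)) -> lt 1 (\prod_(k < m.+1) a k).
Proof.
move=> a_pos; elim: m => [|m IH]; first by rewrite big_ord1.
by rewrite big_ord_recr; apply: sto_trans lt_order _ _ _ IH (pos_mul _ (a_pos _)).
Qed.

Lemma neg_sqr (x : G) : lt x 1 -> lt (x * x) 1.
Proof.
move=> x_neg; apply: (sto_trans lt_order) (x_neg).
by move/(lt_inv _ _ x): x_neg; rewrite mulg1.
Qed.

Lemma pos_of_pos_sqr (x : G) : lt 1 (x * x) -> lt 1 x.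
Proof.
move=> xx_pos; have irr := sto_irr lt_order.
have [x1|/eqP/(sto_total lt_order) [x_neg|//]] := eqVneq x 1.
  by case: (irr 1); rewrite x1 mulg1 in xx_pos.
by case: (irr 1); apply: (sto_trans lt_order) xx_pos (neg_sqr x_neg).
Qed.

Lemma sqr_eq1 (x : G) : x * x = 1 -> x = 1.
Proof.
move=> xx1; have irr := sto_irr lt_order.
have [//|/eqP/(sto_total lt_order) [x_neg|x_pos]] := eqVneq x 1.
  by case: (irr 1); rewrite -{1}xx1; apply: neg_sqr.
case: (irr 1); rewrite -{2}xx1; apply: (sto_trans lt_order) (x_pos) _.
exact: pos_mul.
Qed.

End LeftOrder.

Lemma strict_total_order_rev (T : Type) (lt : T -> T -> Prop) :
  strict_total_order lt -> strict_total_order (fun x y => lt y x).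
Proof.
case=> irr trans total; split=> [//|x y z yx zy|x y /total [] xy].
- exact: trans zy yx.
- by right.
- by left.
Qed.

(** * Cyclic sequences satisfying the Fibonacci relations *)

Section CyclicSequence.
Variables (G : groupType) (r : nat) (a : nat -> G).
Hypotheses (a_rel : forall i, \prod_(k < r) a (i + k)%N = a (i + r)%N)
           (a_per : forall i, a (i + r.+1)%N = a i).

Lemma prod_tail (i : nat) : \prod_(k < r) a (i.+1 + k)%N = a i.
Proof. by rewrite a_rel addSnnS a_per. Qed.

(** Both sides of each step are the two evaluations of the product of
    $r + 1$ consecutive terms. *)
Lemma sqr_const (i : nat) : a i * a i = a 0%N * a 0%N.
Proof.
elim: i => [//|i <-]; have <-: a (i.+1 + r)%N = a i by rewrite addSnnS a_per.
transitivity (\prod_(k < r.+1) a (i.+1 + k)%N); last first.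
  by rewrite big_ord_recr /= a_rel.
rewrite big_ord_recl addn0 -{2}(prod_tail i.+1); congr (_ * _).
by apply: eq_bigr => k _; rewrite addSnnS.
Qed.

(** The relations make the sequence strictly decreasing, against periodicity;
    [1 < r] ensures that $a_i$ is $a_{i+1}$ times at least one positive
    factor. *)
Lemma not_all_pos (lt : G -> G -> Prop) :
  strict_total_order lt -> left_invariant lt -> (1 < r)%N ->
  ~ (forall i, lt 1 (a i)).
Proof.
move=> lt_order lt_inv r_gt1 a_pos.
have decr i : lt (a i.+1) (a i).
  rewrite -[X in lt _ X]prod_tail; case: r r_gt1 => [|[|m]] // _.
  rewrite big_ord_recl addn0; apply: (pos_mul lt_inv).
  exact: (pos_prod lt_order lt_inv _ (fun k => a_pos (i.+1 + k.+1)%N)).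
have decr0 i : lt (a i.+1) (a 0%N).
  by elim: i => [//|i]; apply: (sto_trans lt_order).
by apply: (sto_irr lt_order (x := a 0%N)); rewrite -{1}[a 0%N]a_per; apply: decr0.
Qed.

(** By [sqr_const] the sign of the single element $a_0^2$ decides the sign of
    every term. *)
Lemma left_orderable_eq1 (i : nat) : left_orderable G -> (1 < r)%N -> a i = 1.
Proof.
case=> lt [lt_order lt_inv] r_gt1.
have [sq1|/eqP/(sto_total lt_order) sq] := eqVneq (a 0%N * a 0%N) 1.
  by apply: (sqr_eq1 lt_order lt_inv); rewrite sqr_const.
case: sq => [sq_neg|sq_pos]; exfalso.
  have gt_order := strict_total_order_rev lt_order.
  have gt_inv : left_invariant (fun x y => lt y x) by move=> x y z; apply: lt_inv.
  apply: (not_all_pos gt_order gt_inv r_gt1) => j.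
  by apply: (pos_of_pos_sqr gt_order gt_inv); rewrite sqr_const.
apply: (not_all_pos lt_order lt_inv r_gt1) => j.
by apply: (pos_of_pos_sqr lt_order lt_inv); rewrite sqr_const.
Qed.

End CyclicSequence.

(** * The groups F(r, n) *)

Lemma val_iter_ordS (n k : nat) (i : 'I_n) :
  iter k (@ordS n) i = ((i + k) %% n)%N :> nat.
Proof.
elim: k => [|k IH] /=; first by rewrite addn0 modn_small.
by rewrite IH -addn1 modnDml addn1 addnS.
Qed.

Lemma iter_ordS_inj (n : nat) (i : 'I_n) :
  injective (fun k : 'I_n => iter k (@ordS n) i).
Proof.
move=> k l /(congr1 val) /= /eqP; rewrite !val_iter_ordS eqn_modDl.
by rewrite !modn_small // => /eqP/val_inj.
Qed.

Lemma word_eval_fib (H : groupType) (r n : nat) (f : 'I_n -> H) (i : 'I_n) :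
  word_eval f [seq (iter k (@ordS n) i, false) | k <- iota 0 r] =
  \prod_(k < r) f (iter k (@ordS n) i).
Proof.
by rewrite /word_eval big_map -{1}[r]subn0 -/(index_iota 0 r) big_mkord.
Qed.

Lemma fibonacci_gen_rel (r n : nat) (i : 'I_n) :
  \prod_(k < r) pres_gen (@fib_rels r n) (iter k (@ordS n) i) =
  pres_gen (@fib_rels r n) (iter r (@ordS n) i).
Proof.
rewrite -word_eval_fib.
have rel_i : fib_rels r [seq (iter k (@ordS n) i, false) | k <- iota 0 r]
                        [:: (iter r (@ordS n) i, false)] by exists i.
by rewrite (pres_rel rel_i) /word_eval big_seq1.
Qed.

(** The map to the group of order $2$ (permutations of the booleans) that sends
    $x_0$ and $x_1$ to the transposition [t] and all other generators to $1$
    respects the relations: the exponents of [t] along a whole cycle add up to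
    $2$, so those of $r$ consecutive generators have the same parity as the
    exponent of the remaining one. *)
Lemma fibonacci_gen_neq1 (r : nat) :
  (0 < r)%N -> pres_gen (@fib_rels r r.+1) ord0 <> 1.
Proof.
case: r => // m _; pose t : {perm bool} := tperm false true.
have tX s : t ^+ s = t ^+ odd s.
  rewrite -{1}(odd_double_half s) expgnDr -mul2n expgnA expg2 tperm2.
  by rewrite expg1n mulg1.
pose c (j : 'I_m.+2) : nat := (j < 2)%N.
have sum_c i : (\sum_(k < m.+2) c (iter k (@ordS m.+2) i))%N = 2.
  (* Starting the cycle at [i] instead of 0 only permutes the summands. *)
  transitivity (\sum_(j < m.+2) c j)%N.
    by rewrite [RHS](reindex_inj (@iter_ordS_inj _ i)).
  by rewrite /c !big_ord_recl big1.
have [u v [i [-> ->]]|phi phiM phi_gen] :=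
    @pres_universal _ (@fib_rels m.+1 m.+2) {perm bool} (fun j => t ^+ c j).
  rewrite word_eval_fib /word_eval big_seq1 /=.
  rewrite -(big_morph (fun s => t ^+ s) (expgnDr t) (expg0 t)).
  rewrite tX [RHS]tX; move/(congr1 odd): (sum_c i).
  by rewrite big_ord_recr oddD /=; case: (odd _) (odd _) => [] [].
move=> gen1; have phi1 : phi 1 = 1.
  by apply: (@mulgI _ (phi 1)); rewrite -phiM !mulg1.
have := phi_gen ord0; rewrite gen1 phi1 expg1 => /permP/(_ false).
by rewrite perm1 tpermL.
Qed.

Theorem lemma6 (n : nat) (hn : (2 < n)%N) :
  ~ left_orderable (fibonacci_group (n - 1) n).
Proof.
case: n hn => [//|r]; rewrite subn1 /= => r_gt1 orderable.
pose a k := pres_gen (@fib_rels r r.+1) (iter k (@ordS r.+1) ord0).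
have a_rel i : \prod_(k < r) a (i + k)%N = a (i + r)%N.
  rewrite /a [(i + r)%N]addnC iterD -fibonacci_gen_rel.
  by apply: eq_bigr => k _; rewrite addnC iterD.
have a_per i : a (i + r.+1)%N = a i.
  by congr pres_gen; apply: val_inj; rewrite /= !val_iter_ordS addnA modnDr.
apply: (@fibonacci_gen_neq1 r); first exact: ltnW.
exact: (left_orderable_eq1 a_rel a_per 0 orderable r_gt1).
Qed.
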